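(* Let $X$ be a topological vector space over $K$ and let $\{y_n\}_{n=1}^{\infty}$ be a sequence of elements of $X'$ such that for each $x\in X$ the finite part $\mathrm{F.p.}\lim_{n\to\infty}\langle y_n,x\rangle$ exists. Then for any $\alpha>0$ the function $R_\alpha:X\to K$ is linear, i.e. $R_\alpha$ belongs to the algebraic dual $X'_{\mathrm{al}}$ of $X$.
   Context: $K$ is $\mathbb{R}$ or $\mathbb{C}$; $X'$ is the space of continuous linear functionals on $X$, $X'_{\mathrm{al}}$ is the space of all linear functionals on $X$, and $\langle y,x\rangle$ denotes the evaluation of $y\in X'$ at $x\in X$. Finite part of the limit: for a given $x\in X$, the finite part $\mathrm{F.p.}\lim_{n\to\infty}\langle y_n,x\rangle$ exists and equals $Y(x)\in K$ if there are an integer $k=k_x\ge0$, real exponents $\alpha_1>\cdots>\alpha_k>0$ and scalars $R_{\alpha_1}(x),\ldots,R_{\alpha_k}(x)\in K\setminus\{0\}$ (all allowed to depend on $x$), and scalars $z_n(x)\in K$, such that for all $n\ge1$ $$\langle y_n,x\rangle=n^{\alpha_1}R_{\alpha_1}(x)+\cdots+n^{\alpha_k}R_{\alpha_k}(x)+z_n(x)$$ and $\lim_{n\to\infty}z_n(x)=Y(x)$. Such a decomposition, when it exists, is unique. For every $\alpha>0$ and $x\in X$ one puts $R_\alpha(x)=0$ if $\alpha$ is not one of the exponents $\alpha_1,\ldots,\alpha_k$ occurring in the decomposition of $\langle y_n,x\rangle$; this defines $R_\alpha:X\to K$ for every $\alpha>0$. *)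

(* Defs.v *)
From mathcomp Require Import all_boot all_order all_algebra.
From mathcomp Require Import all_classical all_reals all_analysis.
From mathcomp Require Import complex.

Set Implicit Arguments.
Unset Strict Implicit.
Unset Printing Implicit Defensive.

Import Order.TTheory GRing.Theory Num.Theory.
Import numFieldNormedType.Exports.

Local Open Scope classical_set_scope.
Local Open Scope ring_scope.

Variant scalars := RealScalars | ComplexScalars.

(* The field K, which is R or C; as a numFieldType, it carries the topology
   given by its absolute value. *)
Definition scalar_field (R : realType) (s : scalars) : numFieldType :=
  match s with
  | RealScalars => R
  | ComplexScalars => R[i]
  end.

Definition of_real (R : realType) (s : scalars) : R -> scalar_field R s :=
  match s return R -> scalar_field R s with
  | RealScalars => fun x => x
  | ComplexScalars => fun x => x%:C%C
  end.
Arguments of_real {R} s x.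

(* [topologicalLmodType] requires neither local convexity nor separation
   (unlike [tvsType], which is locally convex). *)
Definition algebraic_dual (K : numFieldType) (X : topologicalLmodType K) :
  set (X -> K) := [set f : X -> K | scalar f].

Definition topological_dual (K : numFieldType) (X : topologicalLmodType K) :
  set (X -> K) := [set f : X -> K | scalar f /\ continuous f].

Arguments algebraic_dual {K} X _.
Arguments topological_dual {K} X _.

Section FinitePart.
Variables (R : realType) (s : scalars).
Local Notation K := (scalar_field R s).

(* The list [e] consists of the pairs (alpha_i, R_{alpha_i}), i = 1, ..., k,
   with k = size e. The terms of index 0 of [u] and [z] play no role. *)
Record fp_decomposition (u : nat -> K) (e : seq (R * K)) (z : nat -> K) (Y : K)
  : Prop := FpDecomposition {
  fp_exponents_decreasing : sorted >%R [seq p.1 | p <- e] ;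
  fp_exponents_gt0 : forall p, p \in e -> 0 < p.1 ;
  fp_coefs_neq0 : forall p, p \in e -> p.2 != 0 ;
  fp_expansion : forall n, (1 <= n)%N ->
    u n = \sum_(p <- e) of_real s (n%:R `^ p.1) * p.2 + z n ;
  fp_remainder_cvg : z n @[n --> \oo] --> Y }.

Definition is_fp_lim (u : nat -> K) (Y : K) : Prop :=
  exists e z, fp_decomposition u e z Y.

Definition fp_lim_exists (u : nat -> K) : Prop := exists Y, is_fp_lim u Y.

Definition is_fp_coef (u : nat -> K) (alpha : R) (c : K) : Prop :=
  exists e z Y, fp_decomposition u e z Y /\
    ((alpha, c) \in e \/ (alpha \notin [seq p.1 | p <- e] /\ c = 0)).

(* The decomposition of [u] is unique if it exists, so [xget] picks the only
   [c] satisfying [is_fp_coef u alpha]; the value is 0 if there is none. *)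
Definition fp_coef (u : nat -> K) (alpha : R) : K :=
  xget 0 [set c | is_fp_coef u alpha c].

End FinitePart.

Definition R_coef (R : realType) (s : scalars)
    (X : topologicalLmodType (scalar_field R s))
    (y : nat -> X -> scalar_field R s) (alpha : R) : X -> scalar_field R s :=
  fun x => fp_coef (fun n => y n x) alpha.

(* Main.v *)
Require Import Defs.
From mathcomp Require Import all_boot all_order all_algebra.
From mathcomp Require Import all_classical all_reals all_analysis.
From mathcomp Require Import complex ring.

(** A sum of growing powers [\sum_i n ^ alpha_i * c_i], with all
    [alpha_i > 0], can converge only if, for each exponent, its coefficients
    add up to 0: divided by [n ^ m], where [m] is the largest exponent, such a
    sum tends both to 0 and to the total coefficient of [m], so the terms with
    exponent [m] cancel and can be discarded ([growth_cvg_total_coef_eq0]).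

    Linearity is an instance of this. Choose decompositions of [y n x],
    [y n x'] and [y n (k *: x + x')]. As [y n] is linear, [k] times the first
    plus the second minus the third is 0 for [n >= 1], hence the same
    combination of their growing parts is minus that of their remainders, and
    converges. That combination is itself a sum of growing powers, whose total
    coefficient at [alpha] is
    [k * R_alpha x + R_alpha x' - R_alpha (k *: x + x')].

    Such a combination may repeat exponents and need not be sorted. This is
    why growing parts are treated below as arbitrary lists of pairs, and why
    the coefficient of an exponent is the sum over its occurrences: both are
    then additive under concatenation of lists. *)

Import Order.TTheory GRing.Theory Num.Theory numFieldNormedType.Exports.

Local Open Scope classical_set_scope.
Local Open Scope ring_scope.

Section GrowingPowers.
Context {R : realType} {s : scalars}.
Local Notation K := (scalar_field R s).
Implicit Types (e : seq (R * K)) (a b : R) (n : nat).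

Lemma of_realM (x y : R) :
  of_real s (x * y) = of_real s x * of_real s y.
Proof. by case: s => //=; exact: rmorphM. Qed.

Lemma of_real1 : of_real s (1 : R) = 1.
Proof. by case: s. Qed.

Lemma of_real_cvg0 (u : nat -> R) :
  u n @[n --> \oo] --> 0 -> of_real s (u n) @[n --> \oo] --> (0 : K).
Proof.
move=> /cvgr0Pnorm_lt u0; case: s => /=.
  by apply/(@cvgr0Pnorm_lt R R^o).
apply/(@cvgr0Pnorm_lt R[i] R[i]^o) => eps.
(* A positive complex number is a positive real number. *)
rewrite ltcE /= => /andP[/eqP Im0 Re_gt0].
near=> n; rewrite normc_def /= expr0n addr0 sqrtr_sqr ltcE /= Im0 eqxx /=.
by near: n; exact: u0.
Unshelve. all: by end_near. Qed.

Lemma powR_nat_cvg0 b : b < 0 -> (n%:R `^ b : R) @[n --> \oo] --> 0.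
Proof.
move=> b_lt0; apply/cvgr0Pnorm_lt => eps eps_gt0.
(* As [b] is negative, [n ^ b < eps] as soon as [n > eps ^ (1 / b)]. *)
near=> n.
have n_gt : eps `^ b^-1 < n%:R by near: n; exact: nbhs_infty_gtr.
have n_gt0 : 0 < n%:R :> R by rewrite (le_lt_trans (powR_ge0 _ _) n_gt).
rewrite ger0_norm ?powR_ge0// -[b]opprK powRN.
rewrite -[eps]invrK ltf_pV2 ?posrE ?invr_gt0 ?powR_gt0//.
have -> : eps^-1 = (eps `^ b^-1) `^ - b.
  by rewrite -powRrM mulrN mulVf ?lt_eqF// powRN powRr1 // ltW.
by apply: gt0_ltr_powR; rewrite ?oppr_gt0 ?nnegrE ?powR_ge0 // ltW.
Unshelve. all: by end_near. Qed.

Definition growth e n : K := \sum_(p <- e) of_real s (n%:R `^ p.1) * p.2.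

Definition total_coef e a : K := \sum_(p <- e | p.1 == a) p.2.

Definition scale_coefs (k : K) e := [seq (p.1, k * p.2) | p <- e].

Lemma growth_cat e1 e2 n : growth (e1 ++ e2) n = growth e1 n + growth e2 n.
Proof. exact: big_cat. Qed.

Lemma growth_scale k e n : growth (scale_coefs k e) n = k * growth e n.
Proof.
rewrite /growth big_map mulr_sumr; apply: eq_bigr => p _ /=.
by rewrite mulrCA.
Qed.

Lemma total_coef_cat e1 e2 a :
  total_coef (e1 ++ e2) a = total_coef e1 a + total_coef e2 a.
Proof. exact: big_cat. Qed.

Lemma total_coef_scale k e a :
  total_coef (scale_coefs k e) a = k * total_coef e a.
Proof. by rewrite /total_coef big_map mulr_sumr. Qed.

Lemma exponents_gt0_cat e1 e2 :
  (forall p, p \in e1 -> 0 < p.1) -> (forall p, p \in e2 -> 0 < p.1) ->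
  forall p, p \in e1 ++ e2 -> 0 < p.1.
Proof. by move=> h1 h2 p; rewrite mem_cat => /orP[/h1|/h2]. Qed.

Lemma exponents_gt0_scale k e :
  (forall p, p \in e -> 0 < p.1) ->
  forall p, p \in scale_coefs k e -> 0 < p.1.
Proof. by move=> h p /mapP[q /h ? ->]. Qed.

Lemma exists_max_exponent e :
  e != [::] -> exists2 q, q \in e & forall p, p \in e -> p.1 <= q.1.
Proof.
elim: e => // p0 [|p1 e] IH _.
  by exists p0 => [|p]; rewrite inE // => /eqP ->.
have [//|q qe qmax] := IH.
have [le_p0q|lt_qp0] := leP p0.1 q.1.
  by exists q => [|p]; rewrite inE ?qe ?orbT // => /orP[/eqP ->|/qmax].
exists p0 => [|p]; rewrite inE ?eqxx // => /orP[/eqP -> //|/qmax le_pq].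
exact: le_trans le_pq (ltW lt_qp0).
Qed.

(** After division by [n ^ m], the terms with exponent [m] are constant and
    those with a smaller exponent vanish in the limit. *)
Lemma growth_div_cvg e m :
  (forall p, p \in e -> p.1 <= m) ->
  of_real s (n%:R `^ - m) * growth e n @[n --> \oo] --> total_coef e m.
Proof.
move=> le_m.
have cvg_term p : p \in e ->
    of_real s (n%:R `^ (p.1 - m)) * p.2 @[n --> \oo] -->
    (if p.1 == m then p.2 else 0).
  move=> /le_m le_pm; case: eqVneq => [->|ne_pm].
    apply: cvg_near_cst; near=> n.
    by rewrite subrr powRr0 of_real1 mul1r.
  rewrite -[X in _ --> X](mul0r p.2); apply: cvgMr_tmp.
  by apply/of_real_cvg0/powR_nat_cvg0; rewrite subr_lt0 lt_neqAle ne_pm.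
rewrite /total_coef big_mkcond big_seq.
apply: cvg_trans (cvg_big add_continuous _ cvg_term).
apply: near_eq_cvg; near=> n.
have n_neq0 : n%:R != 0 :> R.
  by rewrite pnatr_eq0 -lt0n; near: n; exact: nbhs_infty_ge.
rewrite /growth mulr_sumr [RHS]big_seq; apply: eq_bigr => p _.
by rewrite addrC powRD ?n_neq0 ?implybT // of_realM mulrA.
Unshelve. all: by end_near. Qed.

(** Induction on the number of terms: the largest exponent [m] is positive, so
    dividing by [n ^ m] sends the convergent sum to 0, while [growth_div_cvg]
    gives the total coefficient of [m] as the limit. The terms with exponent
    [m] then cancel, and without them the sum is shorter but equal. *)
Lemma growth_cvg_total_coef_eq0 e (l : K) :
  (forall p, p \in e -> 0 < p.1) ->
  growth e n @[n --> \oo] --> l -> forall a, total_coef e a = 0.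
Proof.
have [k] := ubnP (size e); elim: k e => // k IH e le_ek e_gt0 cvg_e a.
have [->|e_neq0] := eqVneq e [::]; first by rewrite /total_coef big_nil.
have [q qe qmax] := exists_max_exponent e e_neq0; set m := q.1 in qmax.
have coef_m : total_coef e m = 0.
  apply: (cvg_unique _ (growth_div_cvg e m qmax)); first exact: norm_hausdorff.
  rewrite /= -(mul0r l); apply: cvgM cvg_e.
  by apply/of_real_cvg0/powR_nat_cvg0; rewrite oppr_lt0 e_gt0.
have [->//|a_neq_m] := eqVneq a m.
pose e' := [seq p <- e | p.1 != m].
have coef_e' : total_coef e a = total_coef e' a.
  rewrite /total_coef big_filter_cond; apply: eq_bigl => p.
  by case: eqVneq => [->|_]; rewrite ?andbF ?a_neq_m.
have growth_e' : growth e = growth e'.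
  apply/funext => n; rewrite /growth (bigID (fun p => p.1 == m)) /=.
  rewrite big_filter -[RHS]add0r; congr (_ + _).
  transitivity (of_real s (n%:R `^ m) * total_coef e m).
    by rewrite mulr_sumr; apply: eq_bigr => p /eqP ->.
  by rewrite coef_m mulr0.
rewrite coef_e'; apply: IH; last by rewrite -growth_e'.
- rewrite ltnS in le_ek; apply: leq_trans le_ek.
  rewrite size_filter ltn_neqAle count_size andbT -all_count.
  by apply/allPn; exists q; rewrite ?eqxx.
- by move=> p; rewrite mem_filter => /andP[_ /e_gt0].
Qed.

(** In a decomposition the exponents are distinct, so the total coefficient of
    an exponent is the single coefficient that it carries. *)
Lemma is_fp_coef_total (u : nat -> K) e z (Y : K) a c :
  fp_decomposition u e z Y ->
  (a, c) \in e \/ (a \notin [seq p.1 | p <- e] /\ c = 0) ->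
  c = total_coef e a.
Proof.
move=> [dec _ _ _ _] [ac_e|[a_e ->]].
  have uniq_e : uniq [seq p.1 | p <- e].
    apply: sorted_uniq dec => [x y w /= lt_xy lt_wx|x]; last exact: ltxx.
    exact: lt_trans lt_wx lt_xy.
  rewrite /total_coef.
  elim: e uniq_e ac_e {dec} => // p e IH /= /andP[p_e /IH{}IH].
  rewrite inE big_cons => /orP[/eqP ac_p|ac_e].
    rewrite -ac_p /= eqxx big_seq_cond big_pred0 ?addr0 // => r.
    apply/negP => /andP[re /eqP ra].
    by case/negP: p_e; rewrite -ac_p /= -ra map_f.
  case: eqP => [pa|_]; last exact: IH.
  by case/negP: p_e; rewrite pa (map_f fst ac_e).
rewrite /total_coef big_seq_cond big_pred0 // => p.
apply/negP => /andP[pe /eqP pa].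
by case/negP: a_e; rewrite -pa map_f.
Qed.

(** The value of [fp_coef] is read off some decomposition of [u], which may
    differ from the one used to show that it is defined. *)
Lemma fp_coef_total (u : nat -> K) a : fp_lim_exists u ->
  exists e z Y, fp_decomposition u e z Y /\ fp_coef u a = total_coef e a.
Proof.
move=> [Y [e [z dec]]].
have [] : is_fp_coef u a (fp_coef u a).
  apply: xgetPex.
  have [/mapP[[b c] bc_e /= ab]|a_e] := boolP (a \in [seq p.1 | p <- e]).
    by exists c, e, z, Y; split=> //; left; rewrite ab.
  by exists 0, e, z, Y; split=> //; right.
move=> e' [z' [Y' [dec' mem']]]; exists e', z', Y'; split=> //.
exact: is_fp_coef_total dec' mem'.
Qed.

(** No matter which decompositions the three coefficients are read off, the
    combination of the growing parts is a convergent sum of growing powers,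
    whose total coefficients vanish. *)
Lemma fp_coef_linear (u v w : nat -> K) (k : K) a :
  fp_lim_exists u -> fp_lim_exists v -> fp_lim_exists w ->
  (forall n, (1 <= n)%N -> w n = k * u n + v n) ->
  fp_coef w a = k * fp_coef u a + fp_coef v a.
Proof.
move=> /(fp_coef_total _ a)[eu [zu [Yu [[_ eu_gt0 _ uE zuE] ->]]]].
move=> /(fp_coef_total _ a)[ev [zv [Yv [[_ ev_gt0 _ vE zvE] ->]]]].
move=> /(fp_coef_total _ a)[ew [zw [Yw [[_ ew_gt0 _ wE zwE] ->]]]] wuv.
(* The growing part of [k * u + v - w], which is 0 for [n >= 1]; it converges
   because it is the opposite of the remainder part. *)
pose e := scale_coefs k eu ++ ev ++ scale_coefs (- 1) ew.
suff : total_coef e a = 0.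
  rewrite !total_coef_cat !total_coef_scale mulN1r addrA.
  by move/eqP; rewrite subr_eq0 => /eqP.
apply: (growth_cvg_total_coef_eq0 _ (Yw - (k * Yu + Yv))).
  by do !apply: exponents_gt0_cat => //; exact: exponents_gt0_scale.
have cvg_z : zw n - (k * zu n + zv n) @[n --> \oo] --> Yw - (k * Yu + Yv).
  by apply: cvgB => //; apply: cvgD => //; exact: cvgMl_tmp.
apply: cvg_trans cvg_z; apply: near_eq_cvg; near=> n.
have n_ge1 : (1 <= n)%N by near: n; exact: nbhs_infty_ge.
rewrite !growth_cat !growth_scale mulN1r.
have wn : growth ew n + zw n = k * (growth eu n + zu n) + (growth ev n + zv n).
  by have := wuv n n_ge1; rewrite uE // vE // wE.
have -> : zw n = k * (growth eu n + zu n) + (growth ev n + zv n) - growth ew n.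
  by rewrite -wn addrC addKr.
ring.
Unshelve. all: by end_near. Qed.

End GrowingPowers.

Theorem lemma2p3 (R : realType) (s : scalars)
    (X : topologicalLmodType (scalar_field R s))
    (y : nat -> X -> scalar_field R s)
    (hy : forall n : nat, (1 <= n)%N -> topological_dual X (y n))
    (hfp : forall x : X, fp_lim_exists (fun n => y n x))
    (alpha : R) (halpha : 0 < alpha) :
  algebraic_dual X (R_coef y alpha).
Proof.
move=> k x x'; apply: fp_coef_linear => // n /hy[lin_y _].
exact: lin_y.
Qed.
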